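(* Let $\Gamma=(\mathcal N,(Y_i,u_i)_{i\in\mathcal N})$, $\mathcal{N}=\{1,\dots,N\}$, be a finite normal-form game that is a potential game. Suppose that $\{\sigma_i(n),\tau_i(n)\}_{i\in\mathcal N,\,n\ge1}$ is a continuous-time embedding of fictitious play such that, with $N_i(t)=\sup\{n:\tau_i(n)\le t\}$, (i) for each $i$, $\lim_{t\to\infty}N_i(t)=\infty$, and (ii) for all $i,j$, $\lim_{t\to\infty}N_i(t)/N_j(t)=1$. Then players learn Nash equilibrium strategies in the sense that $\lim_{t\to\infty}d(q(t),NE)=0$.
   Context: $Y_i$ is the finite action set of player $i$ and $u_i:\prod_jY_j\to\mathbb R$ the utility of player $i$. $\Delta(Y_i)$ is the set of probability distributions on $Y_i$ and $\Delta^N=\prod_i\Delta(Y_i)$. For $p\in\Delta^N$, $U_i(p)=\sum_yu_i(y)p_1(y_1)\cdots p_N(y_N)$; $p=(p_i,p_{-i})$, and $BR_i(p_{-i})=\arg\max_{p_i\in\Delta(Y_i)}U_i(p_i,p_{-i})$. $NE=\{p\in\Delta^N:U_i(p_i,p_{-i})\ge U_i(p_i',p_{-i})\ \forall p_i'\in\Delta(Y_i),\ \forall i\in\mathcal N\}$. $d(x,S)=\inf_{x'\in S}\|x-x'\|$ with the Euclidean norm. Potential game (Monderer–Shapley): there is a function $P:\prod_jY_j\to\mathbb R$ such that $u_i(y_i',y_{-i})-u_i(y_i,y_{-i})=P(y_i',y_{-i})-P(y_i,y_{-i})$ for all $i$, $y_i,y_i'\in Y_i$, $y_{-i}$. Continuous-time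 embedding of fictitious play. For each player $i$, $\{\tau_i(n)\}_{n\ge1}\subset[0,\infty)$ is a (strictly) increasing sequence with $\tau_i(1)=0$; $\tau_i(n)$ is the time at which player $i$ takes her $n$-th action $\sigma_i(n)\in\Delta(Y_i)$. $N_i(t)=\sup\{n:\tau_i(n)\le t\}$ is finite for every $t\in[0,\infty)$. The empirical distribution of player $i$ is $$q_i(t)=\frac1{N_i(t)}\sum_{k=1}^{N_i(t)}\sigma_i(k),\qquad q(t)=(q_1(t),\dots,q_N(t)),$$ and $q_i(t_-)=\lim_{\tilde t\uparrow t}q_i(\tilde t)$. The initial actions $\sigma_i(1)$ are arbitrary, and for all $i$ and $n\ge2$, $\sigma_i(n)\in BR_i(q_{-i}(\tau_i(n)_-))$. All (in)equalities and limits involving random quantities are understood almost surely. *)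

(* Defs.v *)
From HB Require Import structures.
From mathcomp Require Import all_boot all_order all_algebra.
From mathcomp Require Import all_classical all_reals all_analysis.

Set Implicit Arguments.
Unset Strict Implicit.
Unset Printing Implicit Defensive.

Import Order.TTheory GRing.Theory Num.Theory.
Import numFieldNormedType.Exports.

Local Open Scope classical_set_scope.
Local Open Scope ring_scope.

(* Throughout, [eqtype.dfwith p x] with [x : T i] is the profile (x, p_{-i}). *)

Notation pure_profile Y := {dffun forall j, Y j}.

Definition mixed_profile (R : realType) (N : nat) (Y : 'I_N -> finType) : Type :=
  forall i, Y i -> R.

Definition replace_action (N : nat) (Y : 'I_N -> finType)
    (y : pure_profile Y) (i : 'I_N) (a : Y i) : pure_profile Y :=
  [ffun j => eqtype.dfwith y a j].

Definition potential_game (R : realType) (N : nat) (Y : 'I_N -> finType)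
    (u : 'I_N -> pure_profile Y -> R) : Prop :=
  exists P : pure_profile Y -> R,
    forall (i : 'I_N) (a a' : Y i) (y : pure_profile Y),
      u i (replace_action y a') - u i (replace_action y a) =
      P (replace_action y a') - P (replace_action y a).

Definition simplex (R : realType) (T : finType) : set (T -> R) :=
  [set x | (forall y, 0 <= x y) /\ \sum_(y : T) x y = 1].
Arguments simplex : clear implicits.

Definition expected_utility (R : realType) (N : nat) (Y : 'I_N -> finType)
    (u : 'I_N -> pure_profile Y -> R) (i : 'I_N) (p : mixed_profile R Y) : R :=
  \sum_(y : pure_profile Y) u i y * \prod_(j < N) p j (y j).

(* BR_i(p_{-i}): the component [p i] is overwritten, so it plays no role. *)
Definition best_response (R : realType) (N : nat) (Y : 'I_N -> finType)
    (u : 'I_N -> pure_profile Y -> R) (i : 'I_N) (p : mixed_profile R Y) :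
    set (Y i -> R) :=
  [set x | simplex R (Y i) x /\
     forall x', simplex R (Y i) x' ->
       expected_utility u i (eqtype.dfwith p x') <= expected_utility u i (eqtype.dfwith p x)].
Arguments best_response {R N Y} u i p _.

Definition nash_equilibria (R : realType) (N : nat) (Y : 'I_N -> finType)
    (u : 'I_N -> pure_profile Y -> R) : set (mixed_profile R Y) :=
  [set p | (forall i, simplex R (Y i) (p i)) /\
     forall i x', simplex R (Y i) x' ->
       expected_utility u i (eqtype.dfwith p x') <= expected_utility u i p].

Definition euclidean_dist (R : realType) (N : nat) (Y : 'I_N -> finType)
    (p p' : mixed_profile R Y) : R :=
  Num.sqrt (\sum_(i < N) \sum_(y : Y i) (p i y - p' i y) ^+ 2).

(* Extended-real valued, so that the distance to the empty set is +oo
   (the real-valued [inf] of the empty set would be 0). *)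
Definition dist_to_set (R : realType) (N : nat) (Y : 'I_N -> finType)
    (p : mixed_profile R Y) (S : set (mixed_profile R Y)) : \bar R :=
  ereal_inf [set (euclidean_dist p p')%:E | p' in S].

(* Action sequences are indexed by n >= 1; values at index 0 are never used. *)
Definition actions_by (R : realType) (tau : nat -> R) (t : R) : set nat :=
  [set n | (1 <= n)%N /\ tau n <= t].

(* The supremum is the intended one when [actions_by tau t] is bounded, which
   [fp_embedding] requires for t >= 0. *)
Definition num_actions (R : realType) (tau : nat -> R) (t : R) : nat :=
  supremum 0%N (actions_by tau t).

Definition empirical (R : realType) (N : nat) (Y : 'I_N -> finType)
    (tau : 'I_N -> nat -> R) (sigma : forall i : 'I_N, nat -> Y i -> R)
    (t : R) : mixed_profile R Y :=
  fun i y => (num_actions (tau i) t)%:R^-1 *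
    \sum_(1 <= k < (num_actions (tau i) t).+1) sigma i k y.
Arguments empirical {R N Y} tau sigma t i _.

Definition empirical_left (R : realType) (N : nat) (Y : 'I_N -> finType)
    (tau : 'I_N -> nat -> R) (sigma : forall i : 'I_N, nat -> Y i -> R)
    (t : R) : mixed_profile R Y :=
  fun i y => lim (empirical tau sigma s i y @[s --> t^'-]).
Arguments empirical_left {R N Y} tau sigma t i _.

Record fp_embedding (R : realType) (N : nat) (Y : 'I_N -> finType)
    (u : 'I_N -> pure_profile Y -> R)
    (tau : 'I_N -> nat -> R) (sigma : forall i : 'I_N, nat -> Y i -> R) :
    Prop := FpEmbedding {
  fp_time_ge0 : forall i n, (1 <= n)%N -> 0 <= tau i n;
  fp_time1 : forall i, tau i 1 = 0;
  fp_time_lt : forall i m n, (1 <= m)%N -> (m < n)%N -> tau i m < tau i n;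
  fp_num_actions_finite : forall i (t : R), 0 <= t ->
    has_ubound (actions_by (tau i) t);
  fp_action : forall i n, (1 <= n)%N -> simplex R (Y i) (sigma i n);
  fp_best_response : forall i n, (2 <= n)%N ->
    best_response u i (empirical_left tau sigma (tau i n)) (sigma i n)
}.

(* Main.v *)
Require Import Defs.
From mathcomp Require Import all_boot all_order all_algebra.
From mathcomp Require Import all_classical all_reals all_analysis.
From mathcomp Require Import ring lra.
Import Order.TTheory GRing.Theory Num.Theory.
Import numFieldNormedType.Exports.
Local Open Scope classical_set_scope.
Local Open Scope ring_scope.
Set Implicit Arguments.
Unset Strict Implicit.
Unset Printing Implicit Defensive.

(** Let [U] be the multilinear extension of the potential to mixed profiles.
    Replacing a utility by the potential does not change what a player gains by
    deviating ([potential_deviation]), so every action of a player is a best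
    reply for [U] too.

    The proof works with the asynchronous process itself and uses [U] as a
    Lyapunov function.  The [n]-th action of player [i] moves her empirical
    distribution by a fraction [1/n] towards a best reply to the current
    profile.  Since [U] is affine in each argument, this raises [U] by exactly
    [1/n] times the gain of the reply, which is nonnegative; players who act at
    the same instant interact only at second order, which costs a multiple of
    [1/n^2] ([potential_step]).  As [U] is bounded and the errors are summable,
    the gains weighted by [1/n] have a finite sum ([weighted_gains_bounded]).

    Weighted summability leaves room for rare large gains, and here the rates
    enter.  Suppose that at a late time [t] some deviation of player [i] gains
    more than [eps].  Until her number of actions has grown by a further
    factor [1 + eta], all counts grow by roughly this factor because they are
    asymptotically equal; hence no empirical distribution moves by more than
    [3 eta] ([empirical_drift]), and each of her best replies in this window
    gains at least [eps / 2].  The window carries weight of order [eta] for the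
    weights [1/n], which contradicts the Cauchy criterion
    ([vanishing_gains]).

    So all deviation gains along the trajectory tend to zero.  By compactness of
    the set of mixed profiles, a profile with small deviation gains is close to
    an equilibrium ([near_equilibrium]); this step also produces the
    equilibria, without a fixed-point theorem. *)

(** * Multilinear extensions of functions on pure profiles *)

Definition mixed_extension {R : realType} {N : nat} {Y : 'I_N -> finType}
    (P : pure_profile Y -> R) (p : mixed_profile R Y) : R :=
  \sum_(y : pure_profile Y) P y * \prod_(j < N) p j (y j).

Lemma mixed_extension_dfwith (R : realType) (N : nat) (Y : 'I_N -> finType)
    (P : pure_profile Y -> R) (p : mixed_profile R Y) (i : 'I_N) (x : Y i -> R) :
  mixed_extension P (eqtype.dfwith p x) =
  \sum_(y : pure_profile Y) P y * (x (y i) * \prod_(j < N | j != i) p j (y j)).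
Proof.
apply: eq_bigr => y _; rewrite (bigD1 i) //= eqtype.dfwith_in.
congr (_ * (_ * _)); apply: eq_bigr => j ji.
by rewrite eqtype.dfwith_out // eq_sym.
Qed.

Lemma mixed_extension_split (R : realType) (N : nat) (Y : 'I_N -> finType)
    (P : pure_profile Y -> R) (p : mixed_profile R Y) (i : 'I_N) :
  mixed_extension P p =
  \sum_(y : pure_profile Y) P y * (p i (y i) * \prod_(j < N | j != i) p j (y j)).
Proof. by apply: eq_bigr => y _; rewrite (bigD1 i). Qed.

Lemma replace_action_in (N : nat) (Y : 'I_N -> finType) (y : pure_profile Y)
    (i : 'I_N) (a : Y i) : replace_action y a i = a.
Proof. by rewrite /replace_action ffunE eqtype.dfwith_in. Qed.

Lemma replace_action_out (N : nat) (Y : 'I_N -> finType) (y : pure_profile Y)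
    (i j : 'I_N) (a : Y i) : i != j -> replace_action y a j = y j.
Proof. by move=> ij; rewrite /replace_action ffunE eqtype.dfwith_out. Qed.

Lemma replace_actionK (N : nat) (Y : 'I_N -> finType) (y : pure_profile Y)
    (i : 'I_N) (a : Y i) : replace_action (replace_action y a) (y i) = y.
Proof.
apply/ffunP => j; have [ij|ij] := eqVneq i j.
  by subst j; rewrite replace_action_in.
by rewrite !replace_action_out.
Qed.

Lemma replace_action_self (N : nat) (Y : 'I_N -> finType) (y : pure_profile Y)
    (i : 'I_N) : replace_action y (y i) = y.
Proof.
apply/ffunP => j; have [ij|ij] := eqVneq i j.
  by subst j; rewrite replace_action_in.
by rewrite replace_action_out.
Qed.

(** Each slice [y i = a] contributes the same total, whatever [a] is, because
    replacing the action of player [i] is a bijection between slices. *)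
Lemma sum_replace_invariant (R : realType) (N : nat) (Y : 'I_N -> finType)
    (i : 'I_N) (H : pure_profile Y -> R) (x x' : Y i -> R) :
  (forall y (a : Y i), H (replace_action y a) = H y) ->
  \sum_a x a = \sum_a x' a ->
  \sum_(y : pure_profile Y) x (y i) * H y =
  \sum_(y : pure_profile Y) x' (y i) * H y.
Proof.
move=> invH sumx.
have slice (a b : Y i) :
    \sum_(y : pure_profile Y | y i == a) H y =
    \sum_(y : pure_profile Y | y i == b) H y.
  rewrite (reindex_onto (fun y : pure_profile Y => replace_action y a)
                        (fun y : pure_profile Y => replace_action y b)) /=.
    apply: eq_big => [y|y _]; last exact: invH.
    rewrite replace_action_in eqxx /=; apply/eqP/eqP => [<-|<-].
      by rewrite replace_action_in.
    apply/ffunP => j; have [ij|ij] := eqVneq i j.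
      by subst j; rewrite replace_action_in.
    by rewrite !replace_action_out.
  by move=> y /eqP <-; apply: replace_actionK.
have total (z : Y i -> R) (b : Y i) :
    \sum_(y : pure_profile Y) z (y i) * H y =
    (\sum_a z a) * \sum_(y : pure_profile Y | y i == b) H y.
  rewrite (partition_big (fun y : pure_profile Y => y i) xpredT) //= mulr_suml.
  apply: eq_bigr => a _; rewrite -(slice a b) mulr_sumr.
  by apply: eq_bigr => y /eqP ->.
have [b _|noa] := pickP (predT : pred (Y i)).
  by rewrite !(total _ b) sumx.
by rewrite !big1 // => y _; have := noa (y i).
Qed.

(** The difference between a utility and the potential does not depend on the
    player's own action, so it cancels between two deviations of equal mass. *)
Lemma potential_deviation (R : realType) (N : nat) (Y : 'I_N -> finType)
    (v P : pure_profile Y -> R) (i : 'I_N) (p : mixed_profile R Y)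
    (x x' : Y i -> R) :
  (forall (a a' : Y i) y, v (replace_action y a') - v (replace_action y a) =
                         P (replace_action y a') - P (replace_action y a)) ->
  simplex R (Y i) x -> simplex R (Y i) x' ->
  mixed_extension v (eqtype.dfwith p x') - mixed_extension v (eqtype.dfwith p x) =
  mixed_extension P (eqtype.dfwith p x') - mixed_extension P (eqtype.dfwith p x).
Proof.
move=> pot [_ sx] [_ sx'].
pose H (y : pure_profile Y) := (v y - P y) * \prod_(j < N | j != i) p j (y j).
suff E : \sum_(y : pure_profile Y) x' (y i) * H y =
         \sum_(y : pure_profile Y) x (y i) * H y.
  have split_diff z : mixed_extension v (eqtype.dfwith p z) =
      mixed_extension P (eqtype.dfwith p z) + \sum_(y : pure_profile Y) z (y i) * H y.
    rewrite !mixed_extension_dfwith -big_split /=; apply: eq_bigr => y _.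
    by rewrite /H; ring.
  by rewrite !split_diff E; ring.
apply: sum_replace_invariant; last by rewrite sx sx'.
move=> y a; rewrite /H; congr (_ * _).
  have := pot (y i) a y; rewrite replace_action_self => e; lra.
by apply: eq_bigr => j ji; rewrite replace_action_out // eq_sym.
Qed.

Lemma prod_norm_le1 (R : realType) (I : Type) (s : seq I) (Q : pred I) (p : I -> R) :
  (forall i, `|p i| <= 1) -> `|\prod_(i <- s | Q i) p i| <= 1.
Proof.
move=> p1; rewrite normr_prod; apply: prodr_ile1 => i _.
by rewrite normr_ge0 p1.
Qed.

Lemma prod_lipschitz (R : realType) (I : Type) (s : seq I) (p p' : I -> R) :
  (forall i, `|p i| <= 1) -> (forall i, `|p' i| <= 1) ->
  `|\prod_(i <- s) p' i - \prod_(i <- s) p i| <= \sum_(i <- s) `|p' i - p i|.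
Proof.
move=> p1 p'1; elim: s => [|k s IH]; first by rewrite !big_nil subrr normr0.
rewrite !big_cons.
have -> : p' k * \prod_(i <- s) p' i - p k * \prod_(i <- s) p i =
  (p' k - p k) * \prod_(i <- s) p' i +
  p k * (\prod_(i <- s) p' i - \prod_(i <- s) p i) by ring.
apply: (le_trans (ler_normD _ _)); rewrite !normrM; apply: lerD.
  by rewrite ler_piMr // prod_norm_le1.
by apply: le_trans IH; rewrite ler_piMl.
Qed.

(** Changing the factors one at a time, the increment of the new factor meets the
    error of the previous ones only in a product of two increments. *)
Lemma prod_second_order (R : realType) (I : eqType) (s : seq I) (p p' : I -> R) :
  uniq s -> (forall i, `|p i| <= 1) -> (forall i, `|p' i| <= 1) ->
  `|\prod_(i <- s) p' i - \prod_(i <- s) p i -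
    \sum_(i <- s) (p' i - p i) * \prod_(j <- s | j != i) p j|
  <= (\sum_(i <- s) `|p' i - p i|) ^+ 2.
Proof.
move=> us p1 p'1; elim: s us => [|k s IH] /=.
  by rewrite !big_nil !subrr normr0 expr0n.
move=> /andP[ks us]; rewrite !big_cons eqxx /=.
have -> : \prod_(j <- s | j != k) p j = \prod_(j <- s) p j.
  rewrite big_seq_cond [RHS]big_seq_cond; apply: eq_bigl => j.
  by case js: (j \in s) => //=; apply: contraNneq ks => <-.
have -> : \sum_(i <- s) (p' i - p i) * \prod_(j <- k :: s | j != i) p j =
    p k * \sum_(i <- s) (p' i - p i) * \prod_(j <- s | j != i) p j.
  rewrite mulr_sumr big_seq_cond [RHS]big_seq_cond.
  apply: eq_bigr => i /andP[si _]; rewrite big_cons ifT; first by ring.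
  by apply: contraNneq ks => ->.
have lip := @prod_lipschitz R I s p p' p1 p'1.
move: (IH us) lip.
set A' := \prod_(i <- s) p' i; set A := \prod_(i <- s) p i.
set D := (X in A' - A - X); set S := \sum_(i <- s) _ => quad lip.
have -> : p' k * A' - p k * A - ((p' k - p k) * A + p k * D) =
  (p' k - p k) * (A' - A) + p k * (A' - A - D) by ring.
have d0 := normr_ge0 (p' k - p k).
have S0 : 0 <= S by apply: sumr_ge0.
apply: (@le_trans _ _ (`|p' k - p k| * S + S ^+ 2)).
  apply: (le_trans (ler_normD _ _)); rewrite !normrM; apply: lerD.
    exact: ler_wpM2l.
  by apply: le_trans quad; rewrite ler_piMl.
by rewrite sqrrD; nra.
Qed.

Definition total_norm {R : realType} {N : nat} {Y : 'I_N -> finType}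
    (P : pure_profile Y -> R) : R := \sum_(y : pure_profile Y) `|P y|.

Lemma total_norm_ge0 (R : realType) (N : nat) (Y : 'I_N -> finType)
    (P : pure_profile Y -> R) : 0 <= total_norm P.
Proof. exact: sumr_ge0. Qed.

Lemma mixed_extension_lipschitz (R : realType) (N : nat) (Y : 'I_N -> finType)
    (P : pure_profile Y -> R) (p p' : mixed_profile R Y) (e : 'I_N -> R) :
  (forall i y, `|p i y| <= 1) -> (forall i y, `|p' i y| <= 1) ->
  (forall i y, `|p' i y - p i y| <= e i) ->
  `|mixed_extension P p' - mixed_extension P p| <= total_norm P * \sum_i e i.
Proof.
move=> p1 p'1 pe; rewrite /mixed_extension -sumrB /total_norm mulr_suml.
apply: (le_trans (ler_norm_sum _ _ _)); apply: ler_sum => y _.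
rewrite -mulrBr normrM; apply: ler_wpM2l => //.
apply: (le_trans (@prod_lipschitz _ _ _ (fun j => p j (y j))
                   (fun j => p' j (y j)) _ _)) => //.
exact: ler_sum.
Qed.

Lemma mixed_extension_norm (R : realType) (N : nat) (Y : 'I_N -> finType)
    (P : pure_profile Y -> R) (p : mixed_profile R Y) :
  (forall i y, `|p i y| <= 1) -> `|mixed_extension P p| <= total_norm P.
Proof.
move=> p1; apply: (le_trans (ler_norm_sum _ _ _)); apply: ler_sum => y _.
by rewrite normrM ler_piMr // prod_norm_le1.
Qed.

Lemma simplex_itv (R : realType) (T : finType) (x : T -> R) y :
  simplex R T x -> 0 <= x y <= 1.
Proof.
case=> x0 x1; rewrite x0 /= -x1 (bigD1 y) //= lerDl.
exact: sumr_ge0.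
Qed.

Lemma dfwith_id (R : realType) (N : nat) (Y : 'I_N -> finType)
    (p : mixed_profile R Y) (i : 'I_N) : eqtype.dfwith p (p i) = p.
Proof.
apply: functional_extensionality_dep => j; have [ij|ij] := eqVneq i j.
  by subst j; rewrite eqtype.dfwith_in.
by rewrite eqtype.dfwith_out.
Qed.

Lemma dfwith_norm (R : realType) (N : nat) (Y : 'I_N -> finType)
    (p : mixed_profile R Y) i (x : Y i -> R) :
  simplex R (Y i) x -> (forall j y, `|p j y| <= 1) ->
  forall j y, `|eqtype.dfwith p x j y| <= 1.
Proof.
move=> xS p1 j y; have [ij|ij] := eqVneq i j.
  subst j; rewrite eqtype.dfwith_in.
  by have /andP[? ?] := simplex_itv y xS; rewrite ger0_norm.
by rewrite eqtype.dfwith_out.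
Qed.

(** The constant does not depend on the deviation [x], so this transfers
    approximate equilibrium conditions between nearby profiles for all
    deviations at once. *)
Lemma deviation_gain_lipschitz (R : realType) (N : nat) (Y : 'I_N -> finType)
    (v : pure_profile Y -> R) (p p' : mixed_profile R Y) i (x : Y i -> R) (e : R) :
  simplex R (Y i) x ->
  (forall j y, `|p j y| <= 1) -> (forall j y, `|p' j y| <= 1) -> 0 <= e ->
  (forall j y, `|p' j y - p j y| <= e) ->
  mixed_extension v (eqtype.dfwith p x) - mixed_extension v p <=
  mixed_extension v (eqtype.dfwith p' x) - mixed_extension v p' +
  2 * (total_norm v * N%:R * e).
Proof.
move=> xS p1 p'1 e0 pp'.
have L := @mixed_extension_lipschitz R N Y v _ _ (fun=> e) p1 p'1 (fun j y => pp' j y).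
have L' := @mixed_extension_lipschitz R N Y v _ _ (fun=> e) (dfwith_norm xS p1)
             (dfwith_norm xS p'1).
have {L'} := L' _; move: L; rewrite sumr_const card_ord -[e *+ N]mulr_natl mulrA.
rewrite !ler_norml => /andP[_ L] L'.
have /L'/andP[L'1 _] : forall j y,
    `|eqtype.dfwith p' x j y - eqtype.dfwith p x j y| <= e.
  move=> j y; have [ij|ij] := eqVneq i j.
    by subst j; rewrite !eqtype.dfwith_in subrr normr0.
  by rewrite !eqtype.dfwith_out.
lra.
Qed.

(** If each [p' i] lies a fraction [a i] of the way from [p i] to [x i], the
    first-order term of [prod_second_order] is the sum of the changes caused by
    the individual deviations, because the extension is affine in each
    argument. *)
Lemma mixed_extension_second_order (R : realType) (N : nat) (Y : 'I_N -> finType)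
    (P : pure_profile Y -> R) (p p' x : mixed_profile R Y) (a : 'I_N -> R) :
  (forall i y, 0 <= p i y <= 1) -> (forall i y, 0 <= x i y <= 1) ->
  (forall i y, `|p' i y| <= 1) -> (forall i, 0 <= a i) ->
  (forall i y, p' i y - p i y = a i * (x i y - p i y)) ->
  `|mixed_extension P p' - mixed_extension P p -
    \sum_i a i * (mixed_extension P (eqtype.dfwith p (x i)) - mixed_extension P p)|
  <= total_norm P * (\sum_i a i) ^+ 2.
Proof.
move=> p01 x01 p'1 a0 p'E.
have p1 i y : `|p i y| <= 1.
  by have /andP[? ?] := p01 i y; rewrite ger0_norm.
have -> : \sum_i a i * (mixed_extension P (eqtype.dfwith p (x i)) -
                        mixed_extension P p) =
  \sum_(y : pure_profile Y) P y * \sum_(i < N) (p' i (y i) - p i (y i)) *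
      \prod_(j < N | j != i) p j (y j).
  under [RHS]eq_bigr do rewrite mulr_sumr.
  rewrite exchange_big /=; apply: eq_bigr => i _.
  rewrite mixed_extension_dfwith (mixed_extension_split P p i) -sumrB mulr_sumr.
  by apply: eq_bigr => y _; rewrite p'E; ring.
rewrite /mixed_extension -!sumrB /total_norm mulr_suml.
apply: (le_trans (ler_norm_sum _ _ _)); apply: ler_sum => y _.
rewrite -!mulrBr normrM; apply: ler_wpM2l => //.
apply: (le_trans (@prod_second_order _ _ _ (fun j => p j (y j))
                   (fun j => p' j (y j)) _ _ _)) => //.
  exact: index_enum_uniq.
rewrite ler_sqr ?nnegrE ?sumr_ge0 //; apply: ler_sum => i _.
rewrite p'E normrM (ger0_norm (a0 i)) ler_piMr //.
have := p01 i (y i); have := x01 i (y i); rewrite ler_norml; lra.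
Qed.

Lemma sqr_sum_le (R : realType) (N : nat) (a : 'I_N -> R) :
  (\sum_i a i) ^+ 2 <= N%:R * \sum_i a i ^+ 2.
Proof.
have -> : (\sum_i a i) ^+ 2 = \sum_i \sum_j a i * a j.
  by rewrite expr2 mulr_suml; apply: eq_bigr => i _; rewrite mulr_sumr.
have -> : N%:R * \sum_i a i ^+ 2 =
    \sum_(i < N) \sum_(j < N) (a i ^+ 2 + a j ^+ 2) / 2.
  under [RHS]eq_bigr do rewrite -mulr_suml big_split /= sumr_const card_ord.
  rewrite -mulr_suml big_split /= sumrMnl sumr_const card_ord.
  by field.
by apply: ler_sum => i _; apply: ler_sum => j _; have := sqr_ge0 (a i - a j); lra.
Qed.

(** * Counting actions *)

Record action_times {R : realType} (tau : nat -> R) : Prop := ActionTimes {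
  action_times1 : tau 1 = 0;
  action_times_lt : forall m n, (1 <= m)%N -> (m < n)%N -> tau m < tau n;
  action_times_finite : forall t : R, 0 <= t -> has_ubound (actions_by tau t)
}.

Lemma action_times_le (R : realType) (tau : nat -> R) m n :
  action_times tau -> (1 <= m)%N -> (m <= n)%N -> tau m <= tau n.
Proof.
move=> H m1; rewrite leq_eqVlt => /predU1P[-> //|mn].
exact/ltW/(action_times_lt H).
Qed.

Lemma action_times_ge0 (R : realType) (tau : nat -> R) n :
  action_times tau -> (1 <= n)%N -> 0 <= tau n.
Proof. by move=> H n1; rewrite -(action_times1 H); apply: action_times_le. Qed.

Lemma action_times_gt0 (R : realType) (tau : nat -> R) n :
  action_times tau -> (2 <= n)%N -> 0 < tau n.
Proof. by move=> H n1; rewrite -(action_times1 H); apply: (action_times_lt H). Qed.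

(** Counting and action times form a Galois connection; every other fact about
    [num_actions] is derived from this one. *)
Lemma leq_num_actions (R : realType) (tau : nat -> R) (t : R) n :
  action_times tau -> 0 <= t -> (1 <= n)%N ->
  (n <= num_actions tau t)%N = (tau n <= t).
Proof.
move=> H t0 n1.
have [b bP] := action_times_finite H t0.
have A1 : actions_by tau t 1 by split; rewrite ?(action_times1 H).
have exA : exists m, `[< actions_by tau t m >] by exists 1%N; apply/asboolP.
have bA m : `[< actions_by tau t m >] -> (m <= b)%N by move=> /asboolP/bP.
have [m /asboolP Am mmax] := ex_maxnP exA bA.
have supm : supremums (actions_by tau t) m.
  split; first by move=> k Ak; apply: mmax; apply/asboolP.
  by move=> c; apply.
have A0 : actions_by tau t != set0 by apply/set0P; exists 1%N.
rewrite /num_actions /supremum (negbTE A0).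
have [ubS lbS] := @xgetPex _ 0%N _ (ex_intro _ m supm).
set S := xget _ _ in ubS lbS *.
apply/idP/idP => [nS|tn]; last by apply: ubS; split.
have Sm : (S <= m)%N by apply: lbS; case: supm.
by case: Am => m1; apply: le_trans; apply: action_times_le => //; apply: leq_trans Sm.
Qed.

Lemma num_actions_gt0 (R : realType) (tau : nat -> R) (t : R) :
  action_times tau -> 0 <= t -> (0 < num_actions tau t)%N.
Proof. by move=> H t0; rewrite leq_num_actions // (action_times1 H). Qed.

Lemma action_time_num_actions (R : realType) (tau : nat -> R) (t : R) :
  action_times tau -> 0 <= t -> tau (num_actions tau t) <= t.
Proof. by move=> H t0; rewrite -leq_num_actions // num_actions_gt0. Qed.

Lemma num_actions_unique (R : realType) (tau : nat -> R) (t : R) m :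
  action_times tau -> 0 <= t -> (1 <= m)%N -> tau m <= t -> t < tau m.+1 ->
  num_actions tau t = m.
Proof.
move=> H t0 m1 tm tm1; apply/eqP; rewrite eqn_leq leq_num_actions // tm andbT.
by rewrite leqNgt leq_num_actions // -ltNge.
Qed.

Lemma num_actions_mono (R : realType) (tau : nat -> R) (s t : R) :
  action_times tau -> 0 <= s -> s <= t -> (num_actions tau s <= num_actions tau t)%N.
Proof.
move=> H s0 st; rewrite leq_num_actions ?num_actions_gt0 ?(le_trans s0) //.
exact: le_trans (action_time_num_actions H s0) st.
Qed.

Lemma num_actions_at (R : realType) (tau : nat -> R) n :
  action_times tau -> (1 <= n)%N -> num_actions tau (tau n) = n.
Proof.
move=> H n1; apply: num_actions_unique => //; first exact: action_times_ge0.
exact: (action_times_lt H).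
Qed.

(** The left limit of the count at [t]: an action taken exactly at [t] is left
    out. *)
Definition num_actions_before {R : realType} (tau : nat -> R) (t : R) : nat :=
  (num_actions tau t - (tau (num_actions tau t) == t))%N.

Lemma leq_num_actions_before (R : realType) (tau : nat -> R) (t : R) n :
  action_times tau -> 0 < t -> (1 <= n)%N ->
  (n <= num_actions_before tau t)%N = (tau n < t).
Proof.
move=> H t0 n1; rewrite /num_actions_before.
have N0 := num_actions_gt0 H (ltW t0).
have Nt := action_time_num_actions H (ltW t0).
have nN : (n <= num_actions tau t)%N = (tau n <= t).
  exact: leq_num_actions H (ltW t0) n1.
case: eqP => [E|/eqP NE].
  move: N0 E; case: (num_actions tau t) => // m _ <-; rewrite subn1 /=.
  apply/idP/idP => [nm|]; first exact: (action_times_lt H).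
  rewrite ltNge; apply: contraNT; rewrite -ltnNge => mn.
  exact: action_times_le.
rewrite subn0; apply/idP/idP => [nle|/ltW]; last by rewrite nN.
apply: (@le_lt_trans _ _ (tau (num_actions tau t))); first exact: action_times_le.
by rewrite lt_neqAle NE.
Qed.

Lemma num_actions_before_gt0 (R : realType) (tau : nat -> R) (t : R) :
  action_times tau -> 0 < t -> (0 < num_actions_before tau t)%N.
Proof. by move=> H t0; rewrite leq_num_actions_before // (action_times1 H). Qed.

Lemma num_actions_beforeE (R : realType) (tau : nat -> R) (s t : R) :
  action_times tau -> 0 < t -> tau (num_actions_before tau t) <= s -> s < t ->
  num_actions tau s = num_actions_before tau t.
Proof.
move=> H t0 ts st; have M0 := num_actions_before_gt0 H t0.
apply: num_actions_unique => //.
  exact: le_trans (action_times_ge0 H M0) ts.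
apply: (lt_le_trans st); rewrite leNgt -leq_num_actions_before //.
by rewrite ltnn.
Qed.

Lemma num_actions_before_at (R : realType) (tau : nat -> R) n :
  action_times tau -> (1 <= n)%N -> num_actions_before tau (tau n) = n.-1.
Proof.
by move=> H n1; rewrite /num_actions_before num_actions_at // eqxx subn1.
Qed.

(** The counts are locally constant just before [t], so finitely many of them
    reach their left limits at one common time in [t0, t). *)
Lemma exists_time_before (R : realType) (I : finType) (tau : I -> nat -> R)
    (t0 t : R) :
  (forall i, action_times (tau i)) -> 0 <= t0 -> t0 < t ->
  exists2 s, t0 <= s < t &
    forall i, num_actions (tau i) s = num_actions_before (tau i) t.
Proof.
move=> H t00 t0t; have tgt0 := le_lt_trans t00 t0t.
pose s := \big[Order.max/t0]_i tau i (num_actions_before (tau i) t).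
have st : s < t.
  apply/bigmax_ltP; split => // i _.
  by rewrite -leq_num_actions_before // num_actions_before_gt0.
exists s; first by rewrite st andbT bigmax_ge_id.
move=> i; apply: num_actions_beforeE => //.
by rewrite /s; apply: le_bigmax.
Qed.

(** [empirical tau sigma t i] is, by conversion, the average of the actions of
    player [i] up to her count at time [t]; averages depend on the count only. *)
Definition average {R : realType} {T : Type} (x : nat -> T -> R) (n : nat) (y : T) : R :=
  n%:R^-1 * \sum_(1 <= k < n.+1) x k y.

Lemma average_mass (R : realType) (T : Type) (x : nat -> T -> R) n y :
  (0 < n)%N -> n%:R * average x n y = \sum_(1 <= k < n.+1) x k y.
Proof. by move=> n0; rewrite mulVKf // pnatr_eq0 -lt0n. Qed.

Lemma average_simplex (R : realType) (T : finType) (x : nat -> T -> R) n :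
  (forall k, (1 <= k)%N -> simplex R T (x k)) -> (0 < n)%N ->
  simplex R T (average x n).
Proof.
move=> xS n0; split=> [y|].
  rewrite mulr_ge0 ?invr_ge0 ?ler0n // big_nat; apply: sumr_ge0 => k /andP[k1 _].
  by have [] := xS k k1.
rewrite /average -mulr_sumr exchange_big /= big_nat.
under eq_bigr => k /andP[k1 _] do rewrite (proj2 (xS k k1)).
by rewrite -big_nat sumr_const_nat subn1 /= mulVf // pnatr_eq0 -lt0n.
Qed.

Lemma averageS (R : realType) (T : Type) (x : nat -> T -> R) n y : (0 < n)%N ->
  average x n.+1 y - average x n y = n.+1%:R^-1 * (x n.+1 y - average x n y).
Proof.
move=> n0; rewrite {1}/average big_nat_recr //= -average_mass //.
have : (n.+1%:R : R) != 0 by rewrite pnatr_eq0.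
by rewrite -natr1 => nz; field.
Qed.

(** The average moves only by the share of the terms with index in ]a, b], each
    of which differs from the old average by at most 1. *)
Lemma average_dist (R : realType) (T : finType) (x : nat -> T -> R) a b y :
  (forall k, (1 <= k)%N -> simplex R T (x k)) -> (0 < a)%N -> (a <= b)%N ->
  `|average x b y - average x a y| <= 1 - a%:R / b%:R.
Proof.
move=> xS a0 ab; have b0 := leq_trans a0 ab.
have bR : 0 < (b%:R : R) by rewrite ltr0n.
rewrite -(ler_pM2l bR) -{1}(gtr0_norm bR) -normrM.
have -> : b%:R * (average x b y - average x a y) =
    \sum_(a.+1 <= k < b.+1) (x k y - average x a y).
  rewrite sumrB sumr_const_nat subSS -[average x a y *+ _]mulr_natl natrB // mulrBl mulrBr.
  rewrite !average_mass // (big_cat_nat _ (n := a.+1)) //=; ring.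
apply: (le_trans (ler_norm_sum _ _ _)).
have -> : b%:R * (1 - a%:R / b%:R) = \sum_(a.+1 <= k < b.+1) (1 : R).
  rewrite sumr_const_nat subSS natrB //; field.
  by rewrite pnatr_eq0 -lt0n.
rewrite big_nat [leRHS]big_nat; apply: ler_sum => k /andP[ak _].
have := simplex_itv y (xS k (leq_trans _ ak)) => /(_ isT).
have := simplex_itv y (average_simplex xS a0).
rewrite ler_norml; lra.
Qed.

Lemma empirical_leftE (R : realType) (N : nat) (Y : 'I_N -> finType)
    (tau : 'I_N -> nat -> R) (sigma : forall i : 'I_N, nat -> Y i -> R) (t : R) i y :
  action_times (tau i) -> 0 < t ->
  empirical_left tau sigma t i y =
  average (sigma i) (num_actions_before (tau i) t) y.
Proof.
move=> H t0; apply: lim_near_cst => //.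
near=> s; rewrite /empirical (@num_actions_beforeE _ (tau i) s t) //.
near: s; apply: nbhs_left_ge.
by rewrite -leq_num_actions_before // num_actions_before_gt0.
Unshelve. all: by end_near. Qed.

(** * The potential along a trajectory *)

Definition potential_gain {R : realType} {N : nat} {Y : 'I_N -> finType}
    (P : pure_profile Y -> R) (tau : 'I_N -> nat -> R)
    (sigma : forall i : 'I_N, nat -> Y i -> R) (i : 'I_N) (n : nat) : R :=
  mixed_extension P (eqtype.dfwith (empirical_left tau sigma (tau i n)) (sigma i n)) -
  mixed_extension P (empirical_left tau sigma (tau i n)).

Section Energy.
Variables (R : realType) (N : nat) (Y : 'I_N -> finType).
Variables (P : pure_profile Y -> R) (tau : 'I_N -> nat -> R).
Variable (sigma : forall i : 'I_N, nat -> Y i -> R).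
Arguments sigma : clear implicits.
Hypothesis tauP : forall i, action_times (tau i).
Hypothesis sigmaP : forall i n, (1 <= n)%N -> simplex R (Y i) (sigma i n).

Let count i t := num_actions (tau i) t.
Let q t : mixed_profile R Y := empirical tau sigma t.
Let gain := potential_gain P tau sigma.
Let U := mixed_extension P.
Let C := total_norm P.

Lemma empirical_simplex i t : 0 <= t -> simplex R (Y i) (empirical tau sigma t i).
Proof. by move=> t0; apply: average_simplex; [exact: sigmaP|exact: num_actions_gt0]. Qed.

Lemma empirical_norm i t y : 0 <= t -> `|empirical tau sigma t i y| <= 1.
Proof.
move=> t0; have /andP[? ?] := simplex_itv y (empirical_simplex i t0).
by rewrite ger0_norm.
Qed.

Lemma empirical_eq_count s t :
  (forall i, num_actions (tau i) s = num_actions (tau i) t) ->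
  empirical tau sigma s = empirical tau sigma t.
Proof.
move=> E; apply: functional_extensionality_dep => i; apply/funext => y.
by rewrite /empirical E.
Qed.

Lemma empirical_left_eq s t : 0 < t ->
  (forall i, num_actions (tau i) s = num_actions_before (tau i) t) ->
  empirical_left tau sigma t = empirical tau sigma s.
Proof.
move=> t0 E; apply: functional_extensionality_dep => i; apply/funext => y.
by rewrite empirical_leftE // /empirical E.
Qed.

(** All players acting at time [t] move towards replies to the common profile
    held just before [t]; the potential changes by the weighted sum of their
    individual gains, up to the interaction of simultaneous moves. *)
Lemma potential_step s t :
  0 <= s -> s < t ->
  (forall i, num_actions (tau i) s = num_actions_before (tau i) t) ->
  \sum_(i < N) (tau i (count i t) == t)%:R *
     (gain i (count i t) / (count i t)%:R - C * N%:R / (count i t)%:R ^+ 2)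
  <= U (q t) - U (q s).
Proof.
move=> s0 st E; have t0 := le_lt_trans s0 st.
(* [b i] records whether player [i] acts at time [t]. *)
pose b i := tau i (count i t) == t.
have countE i : count i t = (count i s + b i)%N.
  rewrite /count E /num_actions_before subnK //.
  by apply: leq_trans (leq_b1 _) (num_actions_gt0 _ (ltW t0)).
pose a i : R := (b i)%:R / (count i t)%:R.
pose x : mixed_profile R Y := fun i => sigma i (count i t).
have a0 i : 0 <= a i by rewrite divr_ge0.
have xS i : simplex R (Y i) (x i) by apply/sigmaP/num_actions_gt0/ltW.
have := @mixed_extension_second_order R N Y P (q s) (q t) x a.
move=> /(_ (fun i y => simplex_itv y (empirical_simplex i s0))).
move=> /(_ (fun i y => simplex_itv y (xS i))).
move=> /(_ (fun i y => empirical_norm y (ltW t0)) a0) main.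
have {main} : `|U (q t) - U (q s) -
    \sum_i a i * (U (eqtype.dfwith (q s) (x i)) - U (q s))| <= C * (\sum_i a i) ^+ 2.
  apply: main => i y; rewrite /a /x /q /empirical -/(count i t) -/(count i s).
  rewrite -/(average (sigma i) (count i t) y) -/(average (sigma i) (count i s) y).
  have := countE i; case: (b i) => -> ; last by rewrite addn0 mul0r mul0r subrr.
  by rewrite addn1 mul1r averageS // num_actions_gt0.
rewrite ler_norml => /andP[lower _].
have sq : C * (\sum_i a i) ^+ 2 <= \sum_i C * N%:R * a i ^+ 2.
  rewrite -mulr_sumr -mulrA; apply: ler_wpM2l; first exact: total_norm_ge0.
  exact: sqr_sum_le.
apply: (@le_trans _ _ (\sum_i a i * (U (eqtype.dfwith (q s) (x i)) - U (q s)) -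
                       \sum_i C * N%:R * a i ^+ 2)); last by lra.
rewrite -sumrB; apply: ler_sum => i _; rewrite /a -/(b i).
case bi : (b i); last by rewrite !mul0r expr0n mulr0 subrr.
have -> : gain i (count i t) = U (eqtype.dfwith (q s) (x i)) - U (q s).
  rewrite /gain /potential_gain (eqP bi) -/U.
  by rewrite (empirical_left_eq t0 E).
by rewrite !mul1r exprVn [_^-1 * (_ - _)]mulrC.
Qed.

(** Induction on the total number of actions taken: step back from [t] to just
    before the last instant at which somebody acted.  The sums start at [n = 2]
    because the first actions are arbitrary. *)
Lemma potential_lower_bound t : 0 <= t ->
  \sum_(i < N) \sum_(2 <= n < (count i t).+1)
     (gain i n / n%:R - C * N%:R / n%:R ^+ 2) <= U (q t) - U (q 0).
Proof.
have [k] := ubnP (\sum_i count i t)%N.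
elim: k t => // k IH t; rewrite ltnS => tk t0.
have [i0 /= i02|none] := pickP (fun i => (2 <= count i t)%N); last first.
  have c1 i : count i t = 1%N.
    apply/eqP; rewrite eqn_leq num_actions_gt0 // andbT leqNgt.
    exact/negbT/none.
  have -> : q t = q 0.
    apply: empirical_eq_count => i; rewrite -/(count i t) c1.
    by rewrite -(action_times1 (tauP i)) num_actions_at.
  by rewrite subrr big1 // => i _; rewrite c1 big_geq.
(* [t'] is the last instant up to [t] at which some player acted. *)
pose i1 := [arg max_(i > i0) tau i (count i t)]%O.
pose t' := tau i1 (count i1 t).
have tmax j : tau j (count j t) <= t'.
  by rewrite /t' /i1; case: arg_maxP => // i _; apply.
have t'0 : 0 < t'.
  by apply: lt_le_trans (tmax i0); apply: (action_times_gt0 (tauP i0)).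
have t't : t' <= t by apply: action_time_num_actions.
have countE i : num_actions (tau i) t' = count i t.
  apply: num_actions_unique => //; [exact: ltW|exact: num_actions_gt0|].
  by apply: (le_lt_trans t't); rewrite ltNge -leq_num_actions // ltnn.
have qE : q t = q t' by apply: empirical_eq_count => i; rewrite countE.
have [s /andP[s0 st] sE] := exists_time_before tauP (lexx 0) t'0.
have := potential_step s0 st sE.
pose b i := tau i (count i t) == t'.
have countD i : count i t = (count i s + b i)%N.
  rewrite /b -countE /count sE /num_actions_before subnK //.
  by apply: leq_trans (leq_b1 _) (num_actions_gt0 _ (ltW t'0)).
have sk : (\sum_i count i s < k)%N.
  apply: leq_trans tk; rewrite (bigD1 i1) //= [leqRHS](bigD1 i1) //=.
  rewrite -addSn; apply: leq_add.
    by rewrite countD /b eqxx addn1.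
  by apply: leq_sum => i _; rewrite countD leq_addr.
move=> step; have := IH s sk s0; rewrite qE => prev.
rewrite -[_ - U (q 0)](subrKA (U (q s))) addrC.
apply: le_trans (lerD prev step); rewrite -big_split /=.
apply: ler_sum => i _; rewrite [count i t'](countE i).
rewrite -/(b i) countD; case: (b i); last by rewrite mul0r addr0 addn0.
rewrite mul1r addn1 big_nat_recr //= ltnS; exact: num_actions_gt0.
Qed.

End Energy.

(** Comparison with the telescoping sum of [1/(n-1) - 1/n]. *)
Lemma sum_inv_sqr_le (R : realType) m :
  \sum_(2 <= n < m) (n%:R ^+ 2)^-1 <= (1 : R).
Proof.
suff [m2|m2] : (m <= 2)%N \/ \sum_(2 <= n < m) (n%:R ^+ 2)^-1 <= 1 - (m.-1%:R)^-1 :> R.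
- by rewrite big_geq.
- by apply: (le_trans m2); rewrite gerBl invr_ge0.
elim: m => [|m [IH|IH]]; first by left.
  move: IH; rewrite leq_eqVlt => /predU1P[->|]; last by left.
  by right; rewrite big_nat1 /=; lra.
have [m2|m2] := leqP 2 m; last by left.
right; rewrite big_nat_recr //=; apply: (le_trans (lerD IH (lexx _))).
case: m m2 {IH} => // m m1 /=.
have mR : (1 : R) <= m%:R by rewrite ler1n.
rewrite -natr1.
have -> : (m%:R : R)^-1 = (m%:R + 1)^-1 + (m%:R * (m%:R + 1))^-1.
  by field; apply/andP; split; apply: lt0r_neq0; lra.
suff : (((m%:R : R) + 1) ^+ 2)^-1 <= (m%:R * (m%:R + 1))^-1 by lra.
by rewrite lef_pV2 ?posrE; nra.
Qed.

Lemma small_tails (R : realType) (f : nat -> R) (B : R) :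
  (forall n, (2 <= n)%N -> 0 <= f n) ->
  (forall m, \sum_(2 <= n < m) f n <= B) ->
  forall e, 0 < e -> exists m0, forall a b, (m0 <= a)%N -> (a <= b)%N ->
    \sum_(a <= n < b) f n < e.
Proof.
move=> f0 fB e e0.
pose E := [set S | exists m, S = \sum_(2 <= n < m) f n].
have hE : has_sup E.
  by split; [exists 0; exists 0%N; rewrite big_geq|exists B => _ [m ->]].
have [_ [m ->] mS] := sup_adherent e0 hE.
exists (maxn 2 m) => a b; rewrite geq_max => /andP[a2 ma] ab.
have Sb : \sum_(2 <= n < b) f n <= sup E by apply: sup_upper_bound => //; exists b.
move: Sb; rewrite (big_cat_nat _ (n := a)) //=.
suff : \sum_(2 <= n < m) f n <= \sum_(2 <= n < a) f n by lra.
have [m2|m2] := leqP 2 m.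
  rewrite [leRHS](big_cat_nat _ (n := m)) //= lerDl big_nat.
  by apply: sumr_ge0 => n /andP[mn _]; apply: f0; apply: leq_trans mn.
rewrite big_geq ?(ltnW m2) // big_nat; apply: sumr_ge0 => n /andP[n2 _].
exact: f0.
Qed.

(** * Deviation gains vanish *)

Section VanishingGains.
Variables (R : realType) (N : nat) (Y : 'I_N -> finType).
Variables (P : pure_profile Y -> R) (tau : 'I_N -> nat -> R).
Variable (sigma : forall i : 'I_N, nat -> Y i -> R).
Arguments sigma : clear implicits.
Hypothesis tauP : forall i, action_times (tau i).
Hypothesis sigmaP : forall i n, (1 <= n)%N -> simplex R (Y i) (sigma i n).
Hypothesis replyP : forall i n x', (2 <= n)%N -> simplex R (Y i) x' ->
  mixed_extension P (eqtype.dfwith (empirical_left tau sigma (tau i n)) x') <=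
  mixed_extension P (eqtype.dfwith (empirical_left tau sigma (tau i n)) (sigma i n)).

Let count i t := num_actions (tau i) t.
Let q t : mixed_profile R Y := empirical tau sigma t.
Arguments q : clear implicits.
Let gain := potential_gain P tau sigma.
Let U := mixed_extension P.
Let C := total_norm P.

(** Turns the left limit at an action time into the value of the process at an
    actual time after [t0], where the counts are known. *)
Lemma profile_before i n t0 : 0 <= t0 -> t0 < tau i n -> (1 <= n)%N ->
  exists2 s, t0 <= s & empirical_left tau sigma (tau i n) = q s /\
                       n = (count i s).+1.
Proof.
move=> t00 t0n n1; have [s /andP[t0s sn] sE] := exists_time_before tauP t00 t0n.
exists s => //; split; first exact: (empirical_left_eq sigma tauP (le_lt_trans t00 t0n) sE).
by rewrite /count sE num_actions_before_at // prednK.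
Qed.

Lemma gain_ge0 i n : (2 <= n)%N -> 0 <= gain i n.
Proof.
move=> n2; have n0 : (1 <= n)%N by apply: ltnW.
have [s s0 [E _]] := profile_before (lexx 0) (action_times_gt0 (tauP i) n2) n0.
have := replyP n2 (empirical_simplex tauP sigmaP i s0).
by rewrite /gain /potential_gain E dfwith_id subr_ge0.
Qed.

Lemma weighted_gains_bounded i m :
  \sum_(2 <= n < m) gain i n / n%:R <= 2 * C + C * N%:R * N%:R.
Proof.
have C0 : 0 <= C := total_norm_ge0 P.
case: m => [|[|m]]; [rewrite big_geq //; nra|rewrite big_geq //; nra|].
pose t := tau i m.+1; have t0 : 0 <= t by apply: action_times_ge0.
have := potential_lower_bound P tauP sigmaP t0.
have count_i : num_actions (tau i) t = m.+1 by apply: num_actions_at.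
have Ub s : 0 <= s -> `|U (q s)| <= C.
  by move=> s0; apply: mixed_extension_norm => j y; apply: empirical_norm.
have := Ub t t0; have := Ub 0 (lexx 0); rewrite !ler_norml -/U -/q.
move=> /andP[u0 u1] /andP[u2 u3].
have pen : \sum_(j < N) \sum_(2 <= n < (num_actions (tau j) t).+1)
    C * N%:R / n%:R ^+ 2 <= C * N%:R * N%:R.
  apply: (@le_trans _ _ (\sum_(j < N) C * N%:R)).
    apply: ler_sum => j _; rewrite -mulr_sumr ler_piMr ?mulr_ge0 //.
    exact: sum_inv_sqr_le.
  by rewrite sumr_const card_ord -[C * N%:R *+ N]mulr_natr.
under eq_bigr do rewrite sumrB.
rewrite sumrB (bigD1 i) //= count_i -/gain -/C.
have rest : 0 <= \sum_(j < N | j != i)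
    \sum_(2 <= n < (num_actions (tau j) t).+1) gain j n / n%:R.
  apply: sumr_ge0 => j _; rewrite big_nat; apply: sumr_ge0 => n /andP[n2 _].
  by rewrite divr_ge0 // gain_ge0.
lra.
Qed.

(** The counts [N_j(t0)] and [N_j(s)] are within a factor [1 -/+ eta] of those of
    player [i], whose own count grows by at most [1 + eta]; so the old share
    [N_j(t0) / N_j(s)] is at least [(1 - eta) / (1 + eta)^2 >= 1 - 3 eta]. *)
Lemma empirical_drift (eta : R) t0 s i :
  0 < eta -> eta <= 3^-1 -> 0 <= t0 -> t0 <= s ->
  (forall t j, t0 <= t -> `|(count j t)%:R / (count i t)%:R - 1| <= eta) ->
  (count i s)%:R <= (1 + eta) * (count i t0)%:R ->
  forall j (y : Y j), `|q s j y - q t0 j y| <= 3 * eta.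
Proof.
move=> eta0 eta3 t00 t0s ratio window j y.
have s0 := le_trans t00 t0s.
have cpos k t : 0 <= t -> (0 : R) < (count k t)%:R.
  by move=> ?; rewrite ltr0n; apply: num_actions_gt0.
have step := average_dist y (@sigmaP j) (num_actions_gt0 (tauP j) t00)
               (num_actions_mono (tauP j) t00 t0s).
apply: (le_trans step); rewrite -/(count j t0) -/(count j s).
have := ratio t0 j (lexx t0); have := ratio s j t0s.
rewrite !ler_norml => /andP[_ up] /andP[low _].
have := cpos i t0 t00; have := cpos i s s0; have := cpos j s s0.
set A := (count j t0)%:R in low *; set B := (count j s)%:R in up *.
set m := (count i t0)%:R in low window *; set n := (count i s)%:R in up window *.
move=> B0 n0 m0.
have {up} up : B <= (1 + eta) * n by rewrite -ler_pdivrMr //; lra.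
have {low} low : (1 - eta) * m <= A by rewrite -ler_pdivlMr //; lra.
suff : 1 - 3 * eta <= A / B by lra.
rewrite ler_pdivlMr //; apply: le_trans low.
have h1 : 0 <= 1 - 3 * eta by lra.
apply: (le_trans (ler_wpM2l h1 up)); rewrite mulrA.
apply: (@le_trans _ _ ((1 - 3 * eta) * (1 + eta) * ((1 + eta) * m))).
  by apply: ler_wpM2l window; apply: mulr_ge0; lra.
rewrite mulrA; apply: ler_wpM2r; first exact: ltW.
have : 0 <= eta * eta by nra.
have : 0 <= eta * eta * eta by nra.
have -> : (1 - 3 * eta) * (1 + eta) * (1 + eta) =
  1 - eta - 5 * (eta * eta) - 3 * (eta * eta * eta) by ring.
lra.
Qed.

Hypothesis countP : forall i, count i t @[t --> +oo%R] --> \oo.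
Hypothesis ratioP : forall i j,
  ((count i t)%:R / (count j t)%:R : R) @[t --> +oo%R] --> (1 : R).

(** A deviation of player [i] that gains more than [eps] at [t0] forces gains of
    at least [eps / 2] for her next [k] actions, where [k] is about
    [eta * m] and [m] is her count at [t0].  Their weighted sum is at least
    [eps * eta / 8], more than a late block of a convergent series allows. *)
Lemma vanishing_gains (eps : R) : 0 < eps ->
  \forall t \near +oo%R, forall i x', simplex R (Y i) x' ->
    U (eqtype.dfwith (q t) x') - U (q t) <= eps.
Proof.
move=> eps0; have C0 : 0 <= C := total_norm_ge0 P.
have CN0 : 0 <= C * N%:R by apply: mulr_ge0.
(* The drift [3 * eta] changes gains by at most [6 * C * N * eta <= eps / 2];
   the summand [3 * eps] keeps [eta <= 1/3]. *)
pose eta := eps / (12 * (C * N%:R) + 3 * eps).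
have den0 : 0 < 12 * (C * N%:R) + 3 * eps by lra.
have eta0 : 0 < eta by apply: divr_gt0.
have eta3 : eta <= 3^-1 by rewrite ler_pdivrMr //; lra.
have etaC : 12 * (C * N%:R) * eta <= eps.
  by rewrite /eta mulrA ler_pdivrMr //; nra.
have [T ratio] : exists T, forall t i j, T < t ->
    `|(count j t)%:R / (count i t)%:R - 1| <= eta.
  have : \forall t \near +oo%R, forall i j,
      `|(count j t)%:R / (count i t)%:R - 1| <= eta.
    apply: filter_forall => i; apply: filter_forall => j.
    have /cvgrPdist_le /(_ _ eta0) := ratioP j i.
    by apply: filterS => t; rewrite distrC.
  by move=> [T [_ TP]]; exists T => t i j /TP /(_ i j).
apply: filter_forall => i.
have [m0 tail] : exists m0, forall a b, (m0 <= a)%N -> (a <= b)%N ->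
    \sum_(a <= n < b) gain i n / n%:R < eps * eta / 8.
  apply: (@small_tails _ _ _ _ (weighted_gains_bounded i)).
    by move=> n n2; rewrite divr_ge0 // gain_ge0.
  by rewrite divr_gt0 // mulr_gt0.
(* [m >= 2 / eta] makes the rounding of [eta * m] to [k] cost at most half. *)
have large : \forall t \near +oo%R, (maxn m0 (Num.truncn (2 / eta)).+1 <= count i t)%N.
  by move/cvgnyPge: (countP i); apply.
near=> t0 => x' x'S; rewrite leNgt; apply/negP => big_gain.
have t00 : 0 <= t0 by near: t0; apply: nbhs_pinfty_ge; exact: num_real.
have Tt0 : T < t0 by near: t0; apply: nbhs_pinfty_gt; exact: num_real.
have : (maxn m0 (Num.truncn (2 / eta)).+1 <= count i t0)%N by near: t0.
rewrite geq_max => /andP[m0m mbig].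
pose m := count i t0; pose k := Num.truncn (eta * m%:R).
have m_eta : 2 <= eta * m%:R.
  rewrite mulrC -ler_pdivrMr //; apply: ltW.
  have /andP[_ /lt_le_trans] := truncn_itv (ltW (divr_gt0 (ltr0n R 2) eta0)).
  by apply; rewrite ler_nat.
have /andP[kle klt] : k%:R <= eta * m%:R < k.+1%:R.
  by apply: truncn_itv; lra.
have window_gain n : (m < n)%N -> (n <= m + k)%N -> eps / 2 <= gain i n.
  move=> mn nk.
  have n1 : (1 <= n)%N by apply: leq_trans mn.
  have n2 : (2 <= n)%N.
    by apply: leq_trans mn; rewrite ltnS; apply: num_actions_gt0.
  have t0n : t0 < tau i n by rewrite ltNge -leq_num_actions // -ltnNge.
  have [s t0s [E nE]] := profile_before t00 t0n n1.
  have s0 := le_trans t00 t0s.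
  have drift := @empirical_drift eta t0 s i eta0 eta3 t00 t0s.
  have {drift} close : forall j (y : Y j), `|q s j y - q t0 j y| <= 3 * eta.
    apply: drift => [t j t0t|]; first by apply: ratio; apply: lt_le_trans t0t.
    rewrite -/m mulrDl mul1r; apply: (@le_trans _ _ (m + k)%:R).
      by rewrite ler_nat; apply: leq_trans nk; rewrite nE.
    by rewrite natrD lerD2l.
  have e0 : 0 <= 3 * eta by lra.
  have := deviation_gain_lipschitz P x'S
    (fun j y => empirical_norm tauP sigmaP y t00)
    (fun j y => empirical_norm tauP sigmaP y s0) e0 close.
  have := replyP n2 x'S; rewrite /gain /potential_gain E -/U -/(q t0) -/C.
  move: big_gain; rewrite -/U; nra.
have : \sum_(m.+1 <= n < (m + k).+1) gain i n / n%:R < eps * eta / 8.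
  by apply: tail; [apply: leqW|rewrite ltnS leq_addr].
apply/negP; rewrite -leNgt.
have mpos : 0 < (m%:R : R) by rewrite ltr0n; apply: num_actions_gt0.
have mkpos : 0 < (m%:R + k%:R : R) by apply: ltr_pwDl.
apply: (@le_trans _ _ (\sum_(m.+1 <= n < (m + k).+1) (eps / 2 / (m + k)%:R))).
  rewrite sumr_const_nat subSS addKn -[_ *+ k]mulr_natr natrD.
  rewrite [leRHS]mulrAC ler_pdivlMr //; rewrite -natr1 in klt.
  have k2 : eta * m%:R <= 2 * k%:R by lra.
  have km : m%:R + k%:R <= 2 * m%:R :> R by nra.
  apply: (@le_trans _ _ (eps * eta / 8 * (2 * m%:R))).
    by apply: ler_wpM2l => //; rewrite divr_ge0 // mulr_ge0 // ltW.
  by nra.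
rewrite big_nat [leRHS]big_nat; apply: ler_sum => n /andP[mn nk].
have n0 : (0 < n)%N by apply: leq_trans mn.
apply: ler_pM; rewrite ?invr_ge0 ?divr_ge0 ?ler0n ?(ltW eps0) //.
  exact: window_gain.
by rewrite lef_pV2 ?posrE ?ltr0n ?ler_nat // addn_gt0 num_actions_gt0.
Unshelve. all: by end_near. Qed.

End VanishingGains.

(** * Approximate equilibria are close to equilibria *)

(** Sequential compactness of the cube, in the form of a cluster point that is
    approached uniformly in the finitely many coordinates. *)
Lemma cube_cluster_point (R : realType) (T : finType) (x : nat -> T -> R) :
  (forall n k, 0 <= x n k <= 1) ->
  exists z : T -> R,
    forall e, 0 < e -> forall n, exists2 m, (n <= m)%N &
      forall k, `|x m k - z k| < e.
Proof.
move=> x01.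
pose F : set_system (prod_topology (fun _ : T => R : topologicalType)) := x @ \oo.
have FF : ProperFilter F by apply: fmap_proper_filter.
have F01 : F [set f | forall k, `[0, 1]%classic (f k)].
  by exists 0%N => // n _ k; rewrite /= in_itv /= x01.
have := @tychonoff T (fun=> R) (fun=> `[0, 1]%classic)
          (fun=> @segment_compact R 0 1) F FF F01.
move=> [z [_ zF]]; exists z => e e0 n.
have tail : F [set f | exists2 m, (n <= m)%N & f = x m].
  by exists n => // m /= nm; exists m.
have near_z : nbhs (z : prod_topology (fun _ : T => R : topologicalType))
    [set f : T -> R | forall k, `|f k - z k| < e].
  pose z' : prod_topology (fun _ : T => R : topologicalType) := z.
  apply: (@filter_forall _ T (fun k (f : T -> R) => `|f k - z k| < e) (nbhs z')
           (nbhs_filter z')) => k.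
  apply: (@proj_continuous T (fun=> R) k z [set r | `|r - z k| < e]).
  by apply: filterS (nbhsx_ballx (z k) e e0) => r; rewrite /ball /= distrC.
have [f [[m nm ->] close]] := zF _ _ tail near_z.
by exists m.
Qed.

(** Flattening a profile to a single family of reals, on which compactness of the
    cube applies. *)
Definition coordinates {R : realType} {N : nat} {Y : 'I_N -> finType}
    (p : mixed_profile R Y) : {i : 'I_N & Y i} -> R :=
  fun k => p (tag k) (tagged k).

Lemma eq0_of_small (R : realType) (c K : R) :
  (forall e, 0 < e -> `|c| <= K * e) -> c = 0.
Proof.
move=> small; apply/eqP; rewrite -normr_eq0 eq_le normr_ge0 andbT.
apply/ler_addgt0Pr => e e0; rewrite add0r.
have K1 : 0 < `|K| + 1 by apply: ltr_wpDl.
apply: (le_trans (small _ (divr_gt0 e0 K1))).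
rewrite mulrA ler_pdivrMr // [K * e]mulrC ler_pM2l //.
by apply: (le_trans (ler_norm K)); rewrite lerDl.
Qed.

Lemma le0_of_small (R : realType) (c K : R) :
  (forall e, 0 < e -> c <= K * e) -> c <= 0.
Proof.
move=> small; apply/ler_addgt0Pr => e e0; rewrite add0r.
have K1 : 0 < `|K| + 1 by apply: ltr_wpDl.
apply: (le_trans (small _ (divr_gt0 e0 K1))).
rewrite mulrA ler_pdivrMr // [K * e]mulrC ler_pM2l //.
by apply: (le_trans (ler_norm K)); rewrite lerDl.
Qed.

Lemma euclidean_dist_le (R : realType) (N : nat) (Y : 'I_N -> finType)
    (p p' : mixed_profile R Y) (e : R) :
  0 <= e -> (forall k, `|coordinates p k - coordinates p' k| <= e) ->
  euclidean_dist p p' <= #|{: {i : 'I_N & Y i}}|%:R * e.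
Proof.
move=> e0 pp'; rewrite /euclidean_dist.
set K := #|_|.
have Ke : 0 <= K%:R * e by apply: mulr_ge0.
rewrite -(ger0_norm Ke) -sqrtr_sqr ler_wsqrtr //.
rewrite (sig_big_dep xpredT (fun _ => xpredT) (fun i (y : Y i) => (p i y - p' i y) ^+ 2)) /=.
apply: (@le_trans _ _ (\sum_(k : {i : 'I_N & Y i}) e ^+ 2)).
  apply: ler_sum => k _; rewrite -[leLHS]real_normK ?num_real //.
  by rewrite ler_sqr ?nnegrE //; apply: pp'.
rewrite sumr_const -/K -[e ^+ 2 *+ K]mulr_natl exprMn ler_wpM2r ?sqr_ge0 //.
by rewrite -natrX ler_nat; case: (K) => // k; rewrite expnS leq_pmulr ?expn_gt0.
Qed.

(** Otherwise some profiles with deviation gains at most [1/(n+1)] stay at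
    distance [eps] from all equilibria; but by continuity of the gains any
    cluster point of such a sequence is itself an equilibrium. *)
Lemma near_equilibrium (R : realType) (N : nat) (Y : 'I_N -> finType)
    (u : 'I_N -> pure_profile Y -> R) (eps : R) : 0 < eps ->
  exists2 delta, 0 < delta & forall p : mixed_profile R Y,
    (forall i, simplex R (Y i) (p i)) ->
    (forall i x', simplex R (Y i) x' ->
       expected_utility u i (eqtype.dfwith p x') - expected_utility u i p <= delta) ->
    exists2 p', nash_equilibria u p' & euclidean_dist p p' < eps.
Proof.
move=> eps0; apply: contrapT => no_delta.
have /choice[p pP] : forall n : nat, exists p : mixed_profile R Y,
  [/\ forall i, simplex R (Y i) (p i),
      forall i x', simplex R (Y i) x' ->
        expected_utility u i (eqtype.dfwith p x') - expected_utility u i p <=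
        n.+1%:R^-1 &
      forall p', nash_equilibria u p' -> eps <= euclidean_dist p p'].
  move=> n; apply: contrapT => no_p; apply: no_delta.
  exists n.+1%:R^-1; first by rewrite invr_gt0.
  move=> p pS small; apply: contrapT => far; apply: no_p; exists p; split=> // p' p'NE.
  by rewrite leNgt; apply/negP => close; apply: far; exists p'.
have p01 n k : 0 <= coordinates (p n) k <= 1.
  by have [pS _ _] := pP n; exact: (simplex_itv (tagged k) (pS (tag k))).
have p1 n i (y : Y i) : `|p n i y| <= 1.
  by have /andP[? ?] := p01 n (Tagged Y y); rewrite ger0_norm.
have [z zP] := cube_cluster_point p01.
pose pz : mixed_profile R Y := fun i y => z (Tagged Y y).
have approx e n : 0 < e -> exists2 m, (n <= m)%N &
    forall i (y : Y i), `|p m i y - pz i y| < e.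
  by move=> e0; have [m nm close] := zP e e0 n; exists m => // i y; apply: (close (Tagged Y y)).
have pz1 i (y : Y i) : `|pz i y| <= 1.
  apply/ler_addgt0Pr => e e0; have [m _ /(_ i y) close] := approx e 0%N e0.
  have := p1 m i y; move: close; rewrite distrC; have := ler_normB (pz i y - p m i y) (- p m i y).
  by rewrite opprK subrK normrN; lra.
have pzS i : simplex R (Y i) (pz i).
  split=> [y|].
    rewrite -oppr_le0; apply: (@le0_of_small _ _ 1) => e e0.
    have [m _ /(_ i y)] := approx e 0%N e0; rewrite ltr_norml.
    by have := p01 m (Tagged Y y); rewrite /coordinates /=; lra.
  apply/eqP; rewrite -subr_eq0; apply/eqP/(@eq0_of_small _ _ #|Y i|%:R) => e e0.
  have [m _ /(_ i) close] := approx e 0%N e0.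
  have [/(_ i)[_ mass] _ _] := pP m; rewrite -[X in _ - X]mass -sumrB.
  apply: (le_trans (ler_norm_sum _ _ _)); rewrite mulr_natl -sumr_const.
  by apply: ler_sum => y _; rewrite distrC ltW.
have pzNE : nash_equilibria u pz.
  split=> // i x' x'S; rewrite -subr_le0.
  apply: (@le0_of_small _ _ (1 + 2 * (total_norm (u i) * N%:R))) => e e0.
  have [m nm close] := approx e (Num.truncn e^-1) e0.
  have [_ /(_ i x' x'S) gain _] := pP m.
  have := deviation_gain_lipschitz (u i) x'S pz1 (p1 m) (ltW e0)
            (fun j y => ltW (close j y)).
  have me : m.+1%:R^-1 <= e.
    rewrite invf_ple ?posrE // ltW //.
    have /andP[_ lt] := truncn_itv (ltW (eq_ind_r (fun b : bool => b) e0 (invr_gt0 e))).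
    by apply: (lt_le_trans lt); rewrite ler_nat.
  have := le_trans gain me; rewrite /expected_utility -!/(mixed_extension _ _).
  lra.
pose K : R := #|{: {i : 'I_N & Y i}}|%:R + 1.
have K0 : 0 < K by apply: ltr_wpDl.
have e0 : 0 < eps / K / 2 by rewrite !divr_gt0.
have [m _ close] := approx _ 0%N e0.
have [_ _ /(_ pz pzNE)] := pP m; apply/negP; rewrite -ltNge.
apply: (le_lt_trans (euclidean_dist_le (ltW e0) (fun k => ltW (close (tag k) (tagged k))))).
rewrite mulrA ltr_pdivrMr // mulrA ltr_pdivrMr //.
have : 0 <= #|{: {i : 'I_N & Y i}}|%:R :> R by [].
by rewrite /K; nra.
Qed.

(** * Convergence to equilibrium *)

Lemma dist_to_set_lt (R : realType) (N : nat) (Y : 'I_N -> finType)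
    (p p' : mixed_profile R Y) (S : set (mixed_profile R Y)) (e : R) :
  S p' -> euclidean_dist p p' < e -> (0 <= dist_to_set p S < e%:E)%E.
Proof.
move=> Sp' pe; apply/andP; split.
  by apply/le_ereal_inf_tmp => _ [r _ <-]; rewrite lee_fin sqrtr_ge0.
apply: le_lt_trans (_ : ((euclidean_dist p p')%:E < e%:E)%E); last by rewrite lte_fin.
by apply: ereal_inf_lbound; exists p'.
Qed.

(** The pathwise statement: randomness plays no part beyond selecting a
    trajectory, so the theorem follows on the intersection of the finitely many
    almost sure events. *)
Lemma fp_learns_nash (R : realType) (N : nat) (Y : 'I_N -> finType)
    (u : 'I_N -> pure_profile Y -> R) (tau : 'I_N -> nat -> R)
    (sigma : forall i : 'I_N, nat -> Y i -> R) :
  potential_game u -> fp_embedding u tau sigma ->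
  (forall i, num_actions (tau i) t @[t --> +oo%R] --> \oo) ->
  (forall i j, ((num_actions (tau i) t)%:R /
                (num_actions (tau j) t)%:R : R) @[t --> +oo%R] --> (1 : R)) ->
  dist_to_set (empirical tau sigma t) (nash_equilibria u) @[t --> +oo%R] --> 0%E.
Proof.
move=> [P pot] emb countP ratioP.
have tauP i : action_times (tau i).
  split; [exact: (fp_time1 emb)|exact: (fp_time_lt emb)|].
  exact: (fp_num_actions_finite emb).
have sigmaP := fp_action emb.
have replyP i n x' : (2 <= n)%N -> simplex R (Y i) x' ->
  mixed_extension P (eqtype.dfwith (empirical_left tau sigma (tau i n)) x') <=
  mixed_extension P (eqtype.dfwith (empirical_left tau sigma (tau i n)) (sigma i n)).
  move=> n2 x'S; have [sS /(_ x' x'S)] := fp_best_response emb i n2.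
  rewrite -subr_le0 => le0; rewrite -subr_le0.
  by rewrite -(potential_deviation _ (pot i) sS x'S).
have gains := vanishing_gains tauP sigmaP replyP countP ratioP.
have close eps : 0 < eps -> \forall t \near +oo%R,
    (0 <= dist_to_set (empirical tau sigma t) (nash_equilibria u) < eps%:E)%E.
  move=> eps0; have [delta delta0 deltaP] := near_equilibrium u eps0.
  near=> t; have t0 : 0 <= t by near: t; apply: nbhs_pinfty_ge; exact: num_real.
  have qS i : simplex R (Y i) (empirical tau sigma t i).
    exact: (empirical_simplex tauP sigmaP).
  have small : forall i x', simplex R (Y i) x' ->
      mixed_extension P (eqtype.dfwith (empirical tau sigma t) x') -
      mixed_extension P (empirical tau sigma t) <= delta.
    by near: t; apply: gains.
  have [|p' p'NE pp'] := deltaP _ qS; last exact: dist_to_set_lt p'NE pp'.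
  move=> i x' x'S; have := small i x' x'S.
  rewrite -{2 4}(dfwith_id (empirical tau sigma t) i).
  by rewrite -(potential_deviation _ (pot i) (qS i) x'S).
apply/fine_cvgP; split.
  near=> t; have /andP[d0 d1] :
      (0 <= dist_to_set (empirical tau sigma t) (nash_equilibria u) < 1%:E)%E.
    by near: t; apply: close.
  by rewrite ge0_fin_numE // (lt_trans d1) // ltry.
apply/cvgrPdist_lt => eps eps0; near=> t.
have /andP[d0 d1] :
    (0 <= dist_to_set (empirical tau sigma t) (nash_equilibria u) < eps%:E)%E.
  by near: t; apply: close.
rewrite sub0r normrN /= ger0_norm ?fine_ge0 //.
by rewrite -lte_fin fineK // ge0_fin_numE // (lt_trans d1) // ltry.
Unshelve. all: by end_near. Qed.

Unset Implicit Arguments.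

Theorem theorem7p2 (R : realType) (d : measure_display)
  (Omega : measurableType d) (Pr : probability Omega R)
  (N : nat) (Y : 'I_N -> finType) (u : 'I_N -> pure_profile Y -> R)
  (tau : 'I_N -> nat -> Omega -> R)
  (sigma : forall i : 'I_N, nat -> Omega -> Y i -> R)
  (potential : potential_game u)
  (tau_meas : forall i n, (1 <= n)%N -> measurable_fun setT (tau i n))
  (sigma_meas : forall i n y, (1 <= n)%N ->
     measurable_fun setT (fun w => sigma i n w y))
  (embedding : {ae Pr, forall w,
     fp_embedding u (fun i n => tau i n w) (fun i n => sigma i n w)})
  (num_actions_infty : forall i, {ae Pr, forall w,
     num_actions (fun n => tau i n w) t @[t --> +oo%R] --> \oo})
  (num_actions_ratio : forall i j, {ae Pr, forall w,
     ((num_actions (fun n => tau i n w) t)%:R /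
      (num_actions (fun n => tau j n w) t)%:R : R) @[t --> +oo%R] --> (1 : R)}) :
  {ae Pr, forall w,
     dist_to_set
       (empirical (fun i n => tau i n w) (fun i n => sigma i n w) t)
       (nash_equilibria u) @[t --> +oo%R] --> 0%E}.
Proof.
have infty : {ae Pr, forall w, forall i,
    num_actions (fun n => tau i n w) t @[t --> +oo%R] --> \oo}.
  exact: filter_forall.
have ratio : {ae Pr, forall w, forall i j,
    ((num_actions (fun n => tau i n w) t)%:R /
     (num_actions (fun n => tau j n w) t)%:R : R) @[t --> +oo%R] --> (1 : R)}.
  by apply: filter_forall => i; apply: filter_forall.
apply: filterS3 embedding infty ratio => w.
exact: fp_learns_nash.
Qed.
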